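(* Let $(e_i)_{i\ge1}$ be a sequence of natural numbers and $E=\bigcup_{i\ge1}\{e_i\}$. For $i\ge1$ let $\mathcal{P}_i$ be the set of all primes in the arithmetic progression $2^{i+1}\mathbb{Z}+2^i+1$. Then there exist $K_i\in\mathbb{N}$, $i\ge1$, such that for all sets $\emptyset\neq A_i\subseteq\mathcal{P}_i\cap[K_i,\infty)$, $i\ge1$, the set $B=\bigcup_{i\ge1}e_iA_i$ is Besicovitch. If additionally $E$ is primitive, then the $K_i$ can be chosen so that (moreover) every such $B$ is primitive.
   Context: $\mathbb{N}=\{1,2,\dots\}$. For $e\in\mathbb{N}$ and $A\subseteq\mathbb{N}$, $eA=\{ea:a\in A\}$. For $B\subseteq\mathbb{N}$ let $\mathcal{M}_B=\bigcup_{b\in B}b\mathbb{Z}$. $B$ is Besicovitch if the natural density $d(\mathcal{M}_B)=\lim_{n\to\infty}\frac1n|\mathcal{M}_B\cap[1,n]|$ exists. $B$ is primitive if $b\mid b'$ with $b,b'\in B$ implies $b=b'$. *)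

(* Defs.v *)
From mathcomp Require Import all_boot all_order all_algebra.
From mathcomp Require Import all_classical all_reals all_analysis.

Set Implicit Arguments.
Unset Strict Implicit.
Unset Printing Implicit Defensive.

Import Order.TTheory GRing.Theory Num.Theory.
Import numFieldNormedType.Exports.

Local Open Scope classical_set_scope.
Local Open Scope ring_scope.

(* The positive integers are modelled by [nat]; positivity is a hypothesis
   wherever it is needed. *)

Definition scale_set (e : nat) (A : set nat) : set nat :=
  [set (e * a)%N | a in A].

Definition multiples (B : set nat) : set int :=
  \bigcup_(b in B) [set m : int | (b%:Z %| m)%Z].

Definition count_upto (M : set int) (n : nat) : nat :=
  (\sum_(1 <= m < n.+1 | m%:Z \in M) 1)%N.

(* At n = 0 the quotient is the junk value 0, irrelevant for the limit. *)
Definition density_seq (R : realType) (M : set int) : R^nat :=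
  fun n => (count_upto M n)%:R / n%:R.

Definition has_density (R : realType) (M : set int) : Prop :=
  cvgn (density_seq R M).

Definition besicovitch (R : realType) (B : set nat) : Prop :=
  has_density R (multiples B).

Definition primitive (B : set nat) : Prop :=
  forall b b' : nat, B b -> B b' -> (b %| b')%N -> b = b'.

Definition primes_in_class (i : nat) : set nat :=
  [set p : nat | prime p /\ p = (2 ^ i + 1)%N %[mod 2 ^ i.+1]].

Definition range_from1 (e : nat -> nat) : set nat :=
  \bigcup_(i in [set i : nat | (1 <= i)%N]) [set e i].

Definition admissible (K : nat -> nat) (A : nat -> set nat) : Prop :=
  forall i : nat, (1 <= i)%N ->
    A i !=set0 /\ A i `<=` primes_in_class i `&` [set p : nat | (K i <= p)%N].

Definition union_scaled (e : nat -> nat) (A : nat -> set nat) : set nat :=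
  \bigcup_(i in [set i : nat | (1 <= i)%N]) scale_set (e i) (A i).

(* Main.v *)
(** The integers with a divisor in [B] are sorted by their least divisor [a] in
    [B]. The cofactors [m / a] form a divisor-closed periodic set, and for such a
    set an upper bound sieve (Chebyshev and Mertens) shows that its counting
    function up to [x] is at most a constant times [x] times its density, as
    long as [x] is at least a fixed power of the sifting range. So the integers
    up to [n] whose least divisor is at most [n ^ (1 - 1 / s)] are dominated by a
    summable family of densities, and [B] is Besicovitch as soon as the integers
    up to [n] with a divisor [a] in [B], [a > n ^ (1 - 1 / s)], have small upper
    density for large [s].

    If [a = e i * p] with [p >= e i ^ i], then [a] close to [n] forces [p] close
    to [n], and by Mertens the integers up to [n] with a prime divisor
    [p > n ^ (1 - 3 / s)] have density [O (1 / s)]. *)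

Require Import Defs.
From mathcomp Require Import all_boot all_order all_algebra.
From mathcomp Require Import all_classical all_reals all_analysis.
From mathcomp Require Import ring lra zify.

Set Implicit Arguments.
Unset Strict Implicit.
Unset Printing Implicit Defensive.

Import Order.TTheory GRing.Theory Num.Theory.
Import numFieldNormedType.Exports.

Local Open Scope classical_set_scope.
Local Open Scope ring_scope.

(** * The von Mangoldt function and factorials *)

Definition mangoldt (R : realType) (d : nat) : R :=
  \sum_(1 <= p < d.+1 | prime p) \sum_(1 <= j < d.+1 | (p ^ j == d)%N) ln p%:R.

Lemma ln_nat_ge0 (R : realType) (n : nat) : 0 <= ln (n%:R : R).
Proof.
by case: n => [|n]; [rewrite ln0 | rewrite ln_ge0 // ler1n].
Qed.

Lemma ler_ln_nat (R : realType) (m n : nat) :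
  (0 < m)%N -> (m <= n)%N -> ln (m%:R : R) <= ln n%:R.
Proof.
by move=> m0 mn; rewrite ler_ln ?posrE ?ltr0n ?ler_nat // (leq_trans m0).
Qed.

Lemma mangoldt_ge0 (R : realType) (d : nat) : 0 <= mangoldt R d.
Proof. by apply: sumr_ge0 => p _; apply: sumr_ge0 => j _; exact: ln_nat_ge0. Qed.

Lemma mangoldt_prime (R : realType) (p : nat) :
  prime p -> ln p%:R <= mangoldt R p.
Proof.
move=> pp; have p0 := prime_gt0 pp.
rewrite /mangoldt (big_rem p) ?mem_index_iota ?p0 ?ltnS ?leqnn //= pp.
rewrite [X in X + _](big_rem 1%N) ?mem_index_iota /= ?ltnS ?p0 // eqxx.
rewrite -addrA lerDl addr_ge0 //; apply: sumr_ge0 => j _; rewrite ?ln_nat_ge0 //.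
by apply: sumr_ge0 => i _; rewrite ln_nat_ge0.
Qed.

(* Uniform ranges, so that sums over [d] and over [p ^ j] can be exchanged. *)
Lemma mangoldt_widen (R : realType) (d N : nat) : (0 < d)%N -> (d <= N)%N ->
  mangoldt R d =
  \sum_(1 <= p < N.+1 | prime p) \sum_(1 <= j < N.+1 | (p ^ j == d)%N) ln p%:R.
Proof.
move=> d0 dN; rewrite /mangoldt.
rewrite [RHS](big_cat_nat (n := d.+1)) //=.
rewrite [X in _ + X]big1_seq ?addr0 => [|p]; last first.
  rewrite mem_index_iota => /andP[pp /andP[dp _]].
  rewrite big1_seq // => j; rewrite mem_index_iota => /andP[/eqP pj /andP[j1 _]].
  have := prime_gt1 pp; have : (p ^ 1 <= p ^ j)%N by rewrite leq_exp2l ?prime_gt1.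
  lia.
apply: eq_bigr => p pp.
rewrite [RHS](big_cat_nat (n := d.+1)) //=.
rewrite [X in _ + X]big1_seq ?addr0 // => j.
rewrite mem_index_iota => /andP[/eqP pj /andP[dj _]].
have := ltn_expl j (prime_gt1 pp); lia.
Qed.

Lemma ln_prod_nat (R : realType) (I : Type) (r : seq I) (P : pred I) (F : I -> nat) :
  (forall i, P i -> (0 < F i)%N) ->
  ln ((\prod_(i <- r | P i) F i)%N%:R : R) = \sum_(i <- r | P i) ln (F i)%:R.
Proof.
move=> F0; suff [] : (0 < \prod_(i <- r | P i) F i)%N /\
  ln ((\prod_(i <- r | P i) F i)%N%:R : R) = \sum_(i <- r | P i) ln (F i)%:R by [].
elim/big_rec2: _ => [|i x y Pi [y0 IH]]; first by rewrite ln1.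
by rewrite muln_gt0 F0 // natrM lnM ?posrE ?ltr0n ?F0 // IH.
Qed.

Lemma ln_eq_sum_logn (R : realType) (k N : nat) : (0 < k)%N -> (k <= N)%N ->
  ln (k%:R : R) = \sum_(1 <= p < N.+1 | prime p) ln p%:R *+ logn p k.
Proof.
move=> k0 kN; rewrite -{1}(partnT k0) (widen_partn _ kN) ln_prod_nat => [|p _].
  rewrite big_ltn_cond //= {1}lognE /= expn0 ln1 add0r.
  rewrite [RHS]big_mkcond /=; apply: eq_big_nat => p /andP[p1 _].
  case: ifPn => pp; first by rewrite natrX lnXn // ltr0n.
  by rewrite lognE (negbTE pp) /= ln1.
by case: p => [|p]; rewrite ?logn0 // expn_gt0.
Qed.

(** Each prime [p] contributes [ln p] once for every [j >= 1] with [p ^ j] dividing [k], hence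
    [logn p k] times; this recovers the factorization of [k]. *)
Lemma sum_mangoldt_dvd (R : realType) (k N : nat) : (0 < k)%N -> (k <= N)%N ->
  \sum_(1 <= d < N.+1 | (d %| k)%N) mangoldt R d = ln k%:R.
Proof.
move=> k0 kN; rewrite (ln_eq_sum_logn R k0 kN).
rewrite big_mkcond (eq_big_nat _ _ (F2 := fun d => \sum_(1 <= p < N.+1 | prime p)
   \sum_(1 <= j < N.+1) if (p ^ j == d)%N && (d %| k)%N then ln p%:R else 0))
  => [|d /andP[d0 dN]]; last first.
  rewrite (mangoldt_widen R d0 dN); case: ifPn => dk; last first.
    by rewrite big1 // => p _; rewrite big1 // => j _; rewrite andbF.
  by apply: eq_bigr => p _; rewrite big_mkcond /=; apply: eq_bigr => j _; rewrite andbT.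
rewrite exchange_big_nat; apply: eq_bigr => p pp; rewrite exchange_big_nat.
have -> : logn p k = (\sum_(1 <= j < N.+1) (p ^ j %| k))%N.
  rewrite (logn_count_dvd _ pp) [RHS](big_cat_nat (n := k)) ?(leq_trans kN) //=.
  rewrite [X in _ = (_ + X)%N]big1_seq ?addn0 // => j.
  rewrite mem_index_iota => /andP[_ /andP[kj _]].
  apply/eqP; rewrite eqb0; apply/negP => /(dvdn_leq k0).
  have := ltn_expl j (prime_gt1 pp); lia.
rewrite -sumrMnr; apply: eq_big_nat => j /andP[j1 jN].
have [pjk|pjk] := boolP (p ^ j %| k)%N; last first.
  rewrite mulr0n big1 // => d _; case: eqP => //= <-; by rewrite (negbTE pjk).
have := dvdn_leq k0 pjk => pjlek.
rewrite (big_rem (p ^ j)%N) ?mem_index_iota ?expn_gt0 ?prime_gt0 //=;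
  last by rewrite ltnS (leq_trans pjlek).
rewrite eqxx pjk /= big1_seq ?addr0 // => d /andP[_].
by rewrite mem_rem_uniq ?iota_uniq // inE => /andP[dpj _]; rewrite eq_sym (negbTE dpj).
Qed.

(** Passing from [n] to [n.+1] raises [n %/ d] by one exactly when [d] divides [n.+1], so the sum
    grows by [ln n.+1]. The separate bound [N] fixes the range in the induction and lets
    [psi_double] compare [m] with [m.*2]. *)
Lemma ln_fact_mangoldt (R : realType) (n N : nat) : (n <= N)%N ->
  ln (n`!%:R : R) = \sum_(1 <= d < N.+1) mangoldt R d *+ (n %/ d).
Proof.
elim: n => [|n IH] nN.
  by rewrite fact0 ln1 big1 // => d _; rewrite div0n mulr0n.
rewrite factS natrM lnM ?posrE ?ltr0n ?fact_gt0 // IH 1?ltnW //.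
rewrite -(sum_mangoldt_dvd R (ltn0Sn n) nN) [X in X + _]big_mkcond -big_split /=.
apply: eq_big_nat => d /andP[d0 _].
by rewrite divnS // mulrnDr; case: ifP => _; rewrite ?mulr1n ?mulr0n.
Qed.

(** * Chebyshev's upper bound *)

Definition psi (R : realType) (n : nat) : R := \sum_(1 <= d < n.+1) mangoldt R d.

Lemma psi_le (R : realType) (m n : nat) : (m <= n)%N -> psi R m <= psi R n.
Proof.
move=> mn; rewrite /psi (big_cat_nat (n := m.+1) (p := n.+1)) //= lerDl.
by apply: sumr_ge0 => d _; exact: mangoldt_ge0.
Qed.

Lemma bin_double_le (m : nat) : ('C(m.*2, m) <= 2 ^ m.*2)%N.
Proof.
rewrite -[2%N]/(1 + 1)%N expnDn.
have mm : (m < m.*2.+1)%N by rewrite -addnn ltnS leq_addr.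
by rewrite (bigD1 (Ordinal mm)) //= !exp1n !muln1 leq_addr.
Qed.

Lemma ln2_le1 (R : realType) : ln (2%:R : R) <= 1.
Proof. by rewrite (_ : 2%:R = 1 + 1 :> R) ?le_ln1Dx //; lra. Qed.

Lemma ln_bin_double (R : realType) (m : nat) :
  ln ('C(m.*2, m)%:R : R) <= m.*2%:R.
Proof.
apply: (@le_trans _ _ (ln ((2 ^ m.*2)%N%:R))).
  by rewrite ler_ln_nat ?bin_double_le // bin_gt0 -addnn leq_addr.
rewrite natrX lnXn ?ltr0n // -[leLHS]mulr_natr ler_piMl ?ler0n //.
exact: ln2_le1.
Qed.

(* The exponent of [p] in ['C(2 m, m)] is at least the number of powers of [p]
   in the interval from [m + 1] to [2 m]. *)
Lemma psi_double (R : realType) (m : nat) : psi R m.*2 <= psi R m + m.*2%:R.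
Proof.
have mm : (m <= m.*2)%N by rewrite -addnn leq_addr.
have := bin_fact mm; rewrite -{2}addnn addnK => /(congr1 (fun k => ln (k%:R : R))).
rewrite !natrM !lnM ?posrE -?natrM ?ltr0n ?muln_gt0 ?fact_gt0 ?bin_gt0 ?mm //.
rewrite (ln_fact_mangoldt R (leqnn m.*2)) (ln_fact_mangoldt R mm).
have := ln_bin_double R m.
suff : psi R m.*2 + (\sum_(1 <= d < m.*2.+1) mangoldt R d *+ (m %/ d)
    + \sum_(1 <= d < m.*2.+1) mangoldt R d *+ (m %/ d)) <=
  psi R m + \sum_(1 <= d < m.*2.+1) mangoldt R d *+ (m.*2 %/ d) by lra.
rewrite /psi (big_nat_widen 1 m.+1 m.*2.+1) ?ltnS // [X in _ <= X + _]big_mkcond.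
rewrite -!big_split /=.
apply: ler_sum_nat => d /andP[d0 dm].
rewrite -mulrnDr -mulrS; case: ifPn => [dm'|].
  rewrite -mulrS; apply: ler_wpMn2l; first exact: mangoldt_ge0.
  by rewrite ltnS -addnn leq_divRL //; have := leq_trunc_div m d; lia.
rewrite ltnS -ltnNge => md; rewrite add0r divn_small //.
by apply: ler_wpMn2l; [exact: mangoldt_ge0|rewrite divn_gt0].
Qed.

(** Strong induction through [u = uphalf n]: doubling gives at most [6 u + 2 u], and
    [8 u <= 4 (n + 1) <= 6 n] once [n >= 2]. *)
Lemma psi_linear (R : realType) (n : nat) : psi R n <= 6 * n%:R.
Proof.
elim/ltn_ind: n => n IH; have [n1|n1] := leqP n 1.
  case: n n1 IH => [|[|//]] _ _; first by rewrite /psi big_geq ?mulr0.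
  rewrite /psi big_nat1 /mangoldt big1_seq ?mulr_ge0 // => p.
  by rewrite mem_index_iota; case: p => [|[|p]]; rewrite ?andbF.
have un : (uphalf n < n)%N by rewrite uphalfE; lia.
have nu : (n <= (uphalf n).*2)%N by rewrite uphalfE; lia.
apply: (le_trans (psi_le R nu)); apply: (le_trans (psi_double R _)).
have := IH _ un.
have : 2%N%:R * (uphalf n)%:R <= (n%:R + 1 : R).
  by rewrite -natrM natr1 ler_nat uphalfE; lia.
have : (2%:R <= n%:R :> R) by rewrite ler_nat.
rewrite -muln2 natrM; lra.
Qed.

(** * Mertens' estimates for sums over primes *)

Definition mertens_sum (R : realType) (n : nat) : R :=
  \sum_(1 <= d < n.+1) mangoldt R d / d%:R.

Lemma divn_floor_bounds (R : realType) (n d : nat) : (0 < d)%N ->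
  (n %/ d)%:R <= n%:R / d%:R :> R /\ n%:R / d%:R <= (n %/ d)%:R + 1 :> R.
Proof.
move=> d0; rewrite ler_pdivlMr ?ler_pdivrMr ?ltr0n // natr1 -!natrM !ler_nat.
by rewrite leq_trunc_div ltnW // ltn_ceil.
Qed.

Lemma ln_fact_le (R : realType) (n : nat) : ln (n`!%:R : R) <= n%:R * ln n%:R.
Proof.
elim: n => [|n IH]; first by rewrite fact0 ln1 mul0r.
rewrite factS natrM lnM ?posrE ?ltr0n ?fact_gt0 //.
rewrite -[X in _ <= X * _]natr1 mulrDl mul1r addrC lerD2r (le_trans IH) //.
case: n {IH} => [|n]; first by rewrite !mul0r.
by apply: ler_wpM2l => //; exact: ler_ln_nat.
Qed.

(** A weak Stirling bound; the induction step reduces to [m * ln (1 + 1 / m) <= 1]. *)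
Lemma ln_fact_ge (R : realType) (n : nat) : (0 < n)%N ->
  n%:R * ln n%:R - n%:R <= ln (n`!%:R : R).
Proof.
elim: n => // -[|n] IH _; first by rewrite !ln1; lra.
have {IH} IH := IH isT; rewrite factS natrM lnM ?posrE ?ltr0n ?fact_gt0 //.
set m := n.+1 in IH *; have m0 : 0 < m%:R :> R by rewrite ltr0n.
have : m%:R * (ln m.+1%:R - ln m%:R) <= 1 :> R.
  rewrite -ln_div ?posrE ?ltr0n // mulrC -ler_pdivlMr // mul1r.
  rewrite (_ : m.+1%:R / m%:R = 1 + m%:R^-1 :> R); first last.
    by rewrite -natr1 mulrDl mul1r divff ?gt_eqF.
  by rewrite le_ln1Dx // (@lt_trans _ _ 0) ?invr_gt0 // ltrN10.
move: IH; rewrite -[X in _ -> _ -> X * _ - X <= _]natr1; lra.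
Qed.

(** Multiplied by [n], the sum becomes [ln n!] with [n %/ d] replaced by [n / d]; this rounding
    costs at most [psi n], whence the 6. *)
Lemma mertens_le (R : realType) (n : nat) : (0 < n)%N ->
  mertens_sum R n <= ln n%:R + 6.
Proof.
move=> n0; have n0' : 0 < n%:R :> R by rewrite ltr0n.
rewrite -(ler_pM2l n0'); apply: (@le_trans _ _ (ln n`!%:R + psi R n)); last first.
  by rewrite mulrDr [n%:R * 6]mulrC lerD ?ln_fact_le ?psi_linear.
rewrite (ln_fact_mangoldt R (leqnn n)) /psi -big_split mulr_sumr.
apply: ler_sum_nat => d /andP[d0 _] /=.
rewrite mulrCA -[mangoldt R d *+ _]mulr_natr -[X in _ <= _ + X]mulr1 -mulrDr.
rewrite ler_wpM2l ?mangoldt_ge0 //.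
by have [] := divn_floor_bounds R n d0.
Qed.

Lemma mertens_ge (R : realType) (n : nat) : (0 < n)%N ->
  ln n%:R - 1 <= mertens_sum R n.
Proof.
move=> n0; have n0' : 0 < n%:R :> R by rewrite ltr0n.
rewrite -(ler_pM2l n0') mulrBr mulr1 (le_trans (ln_fact_ge R n0)) //.
rewrite (ln_fact_mangoldt R (leqnn n)) mulr_sumr.
apply: ler_sum_nat => d /andP[d0 _]; rewrite mulrCA -[mangoldt R d *+ _]mulr_natr.
by rewrite ler_wpM2l ?mangoldt_ge0 //; have [] := divn_floor_bounds R n d0.
Qed.

(** Subtracting the lower Mertens bound at [y] from the upper one at [n] leaves the terms in
    [(y, n]], where every prime has [mangoldt p >= ln y]. The 7 adds up the errors 6 and 1. *)
Lemma sum_inv_prime_range (R : realType) (y n : nat) : (0 < y)%N -> (y <= n)%N ->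
  ln y%:R * (\sum_(y.+1 <= p < n.+1 | prime p) p%:R^-1) <= ln n%:R - ln y%:R + 7 :> R.
Proof.
move=> y0 yn; have n0 := leq_trans y0 yn.
have := mertens_le R n0; have := mertens_ge R y0.
suff : ln y%:R * (\sum_(y.+1 <= p < n.+1 | prime p) p%:R^-1) + mertens_sum R y <=
  mertens_sum R n by lra.
rewrite /mertens_sum (big_cat_nat (m := 1) (n := y.+1) (p := n.+1)) //=.
rewrite [leLHS]addrC lerD2l.
rewrite big_mkcond mulr_sumr; apply: ler_sum_nat => p /andP[yp _].
have p0 : 0 <= p%:R^-1 :> R by rewrite invr_ge0.
case: ifP => pp; last by rewrite mulr0 mulr_ge0 ?mangoldt_ge0.
by rewrite ler_wpM2r // (le_trans _ (mangoldt_prime R pp)) // ler_ln_nat // ltnW.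
Qed.

(** Applied to [a = ln n] and [b = ln n.+1], this bounds the increments of [ln (ln n)] from below,
    in place of an integral of [1 / (t ln t)]. *)
Lemma ln_ln_step (R : realType) (a b : R) : 0 < a -> 0 < b ->
  1 - a / b <= ln b - ln a.
Proof.
move=> a0 b0; have : ln (a / b) <= a / b - 1.
  rewrite -{1}[a / b](subrK 1) addrC le_ln1Dx //.
  by rewrite ltrBrDl subrr divr_gt0.
by rewrite ln_div ?posrE //; lra.
Qed.

(* Abel summation against [1 / ln d], carried out as an induction on [n]. *)
Lemma sum_inv_prime_abel (R : realType) (n : nat) : (2 <= n)%N ->
  \sum_(2 <= p < n.+1 | prime p) p%:R^-1 <=
  mertens_sum R n / ln n%:R + ln (ln n%:R) - ln (ln 2) + 6 / ln 2 - 6 / ln n%:R :> R.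
Proof.
have mert0 k : 0 <= mangoldt R k / k%:R by rewrite divr_ge0 ?mangoldt_ge0.
have lnpos k : (2 <= k)%N -> 0 < ln (k%:R : R) by move=> k2; rewrite ln_gt0 // ltr1n.
have step k : (2 <= k)%N ->
    (if prime k then k%:R^-1 else 0) <= mangoldt R k / k%:R / ln k%:R :> R.
  move=> k2; case: ifP => pk; last by rewrite divr_ge0 // ltW // lnpos.
  rewrite ler_pdivlMr ?lnpos // mulrC ler_wpM2r ?invr_ge0 //.
  exact: mangoldt_prime.
elim: n => // n IH; rewrite leq_eqVlt => /predU1P[n1|n2].
  rewrite -n1 big_mkcond big_nat1 (le_trans (step 2%N _)) //.
  suff : mangoldt R 2 / 2 / ln 2 <= mertens_sum R 2 / ln 2 by lra.
  rewrite ler_wpM2r ?invr_ge0 ?(ltW (lnpos 2%N _)) //.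
  by rewrite /mertens_sum big_nat_recr //= lerDr sumr_ge0.
have {}n2 : (2 <= n)%N by []; have n0 : (0 < n)%N by rewrite ltnW.
have b0 := lnpos _ n2; have b1 := lnpos _ (leqW n2).
rewrite big_mkcond big_nat_recr //= -big_mkcond /=.
have A1 : mertens_sum R n.+1 = mertens_sum R n + mangoldt R n.+1 / n.+1%:R.
  by rewrite /mertens_sum big_nat_recr.
have := IH n2; have := step _ (leqW n2); rewrite A1.
have V : (ln n.+1%:R)^-1 <= (ln n%:R)^-1 :> R by rewrite lef_pV2 ?posrE // ler_ln_nat.
have := ln_ln_step b0 b1.
(* The summation by parts: the Mertens bound at [n] is weighted by the decrease of [1 / ln]. What
   remains is linear in quantities made opaque for [lra]. *)
have : (mertens_sum R n - ln n%:R - 6) * ((ln n%:R)^-1 - (ln n.+1%:R)^-1) <= 0.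
  rewrite mulr_le0_ge0 ?subr_ge0 //; have := mertens_le R n0; lra.
have : ln n%:R / ln n%:R = 1 :> R by rewrite divff // gt_eqF.
set u := ln n%:R; set v := ln n.+1%:R; set M := mertens_sum R n.
move: (u^-1) (v^-1) (ln u) (ln v) => iu iv lu lv; clearbody M u v.
move: (if prime _ then _ else _) (mangoldt R _ / _) (\sum_(2 <= p < _ | _) _)
  (ln 2) => s1 s2 s3 l2.
lra.
Qed.

Lemma sum_inv_prime (R : realType) : exists C : R, forall n : nat, (2 <= n)%N ->
  \sum_(2 <= p < n.+1 | prime p) p%:R^-1 <= ln (ln n%:R) + C.
Proof.
exists (1 - ln (ln 2) + 6 / ln 2) => n n2; apply: (le_trans (sum_inv_prime_abel R n2)).
have l0 : 0 < ln (n%:R : R) by rewrite ln_gt0 // ltr1n.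
suff : mertens_sum R n / ln n%:R <= 1 + 6 / ln n%:R by lra.
by rewrite ler_pdivrMr // mulrDl mul1r divfK ?gt_eqF // mertens_le // ltnW.
Qed.

(** * A lower bound for the product of [1 - 1 / p] *)

Definition primorial (n : nat) : nat := (\prod_(1 <= p < n.+1 | prime p) p)%N.

Lemma primorial0 : primorial 0 = 1%N.
Proof. by rewrite /primorial big_geq. Qed.

Lemma primorialS (n : nat) :
  primorial n.+1 = (primorial n * (if prime n.+1 then n.+1 else 1))%N.
Proof.
by rewrite /primorial big_mkcond big_nat_recr //= -big_mkcond.
Qed.

Lemma primorial_gt0 (n : nat) : (0 < primorial n)%N.
Proof.
elim: n => [|n IH]; first by rewrite primorial0.
by rewrite primorialS muln_gt0 IH; case: ifP.
Qed.

Lemma dvdn_primorial (p n : nat) : prime p -> (p %| primorial n)%N = (p <= n)%N.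
Proof.
move=> pp; elim: n => [|n IH].
  by rewrite primorial0 dvdn1 leqn0; case: p pp => [|[|p]].
rewrite primorialS Euclid_dvdM // IH; case: ifP => pn.
  by rewrite dvdn_prime2 // [in RHS]leq_eqVlt orbC.
rewrite dvdn1 [in RHS]leq_eqVlt orbC; congr orb.
by apply/eqP/eqP => E; move: pp pn; rewrite E // => ->.
Qed.

Lemma coprime_primorial (b r n : nat) :
  (0 < b)%N -> (b <= n)%N -> coprime (primorial n) r -> coprime b r.
Proof.
move=> b0 bn cop; rewrite /coprime -[_ == _]negbK; apply/negP => g1.
have g0 : (0 < gcdn b r)%N by rewrite gcdn_gt0 b0.
have [p pp pg] : exists2 p, prime p & (p %| gcdn b r)%N.
  by exists (pdiv (gcdn b r)); rewrite ?pdiv_dvd ?pdiv_prime // ltn_neqAle eq_sym g1.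
move: pg; rewrite dvdn_gcd => /andP[pb pr].
have pn : (p %| primorial n)%N by rewrite dvdn_primorial // (leq_trans (dvdn_leq b0 pb)).
have : (p %| gcdn (primorial n) r)%N by rewrite dvdn_gcd pn.
by rewrite (eqP cop) dvdn1; case: p pp {pb pr pn} => [|[|p]].
Qed.

(** A prime [p] multiplies the ratio by [1 - 1 / p], which is at least [expR (- 1 / (p - 1))].
    Replacing [1 / (p - 1)] by [1 / p] costs a difference that, summed over all integers from 2 to
    [n], telescopes to [1 - 1 / n]. *)
Lemma totient_primorial_ge (R : realType) (n : nat) : (0 < n)%N ->
  expR (n%:R^-1 - 1 - \sum_(2 <= p < n.+1 | prime p) p%:R^-1) <=
  (totient (primorial n))%:R / (primorial n)%:R :> R.
Proof.
elim: n => // -[|n] IH _.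
  rewrite primorialS primorial0 big_geq // invr1 subrr subr0 expR0.
  by rewrite mulr1 ler1n totient_gt0.
have {IH} := IH isT; set m := n.+1 => IH.
have m0 : 0 < m%:R :> R by rewrite ltr0n.
have mV : m.+1%:R^-1 <= m%:R^-1 :> R by rewrite lef_pV2 ?posrE ?ltr0n // ler_nat.
rewrite primorialS big_mkcond big_nat_recr //= -big_mkcond /=.
case: ifP => pm; last first.
  by rewrite muln1 addr0 (le_trans _ IH) // ler_expR 2!lerD2r.
rewrite totient_coprime; last first.
  by rewrite coprime_sym prime_coprime // dvdn_primorial // -ltnNge.
rewrite (totient_prime pm) !natrM invfM mulrACA.
apply: le_trans (_ : _ <= expR (m%:R^-1 - 1 - \sum_(2 <= p < m.+1 | prime p) p%:R^-1) *
   expR (- m%:R^-1)) _.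
  rewrite -expRD ler_expR; move: (_.+1%:R^-1) (m%:R^-1) (bigop _ _ _) => x y z; lra.
apply: ler_pM => //; rewrite ?expR_ge0 //.
rewrite expRN -[leRHS]invrK lef_pV2 ?posrE ?expR_gt0 // ?invr_gt0 ?divr_gt0 ?ltr0n //.
rewrite invf_div -natr1 mulrDl divff ?gt_eqF // mul1r; exact: expR_ge1Dx.
Qed.

Lemma totient_primorial_ln (R : realType) : exists2 c : R, 0 < c &
  forall n : nat, (2 <= n)%N ->
    c / ln n%:R <= (totient (primorial n))%:R / (primorial n)%:R.
Proof.
have [C HC] := sum_inv_prime R; exists (expR (- 1 - C)) => [|n n2]; first exact: expR_gt0.
have l0 : 0 < ln (n%:R : R) by rewrite ln_gt0 // ltr1n.
apply: le_trans (totient_primorial_ge R (ltnW n2)).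
rewrite -[ln _]lnK ?posrE // -expRN -expRD ler_expR.
have := HC n n2; have : 0 <= n%:R^-1 :> R by rewrite invr_ge0.
lra.
Qed.

(** * Counting functions of periodic sets *)

Definition cnt (P : pred nat) (n : nat) : nat := (\sum_(1 <= m < n.+1) P m)%N.

Lemma cnt0 (P : pred nat) : cnt P 0 = 0%N.
Proof. by rewrite /cnt big_geq. Qed.

Lemma cntS (P : pred nat) (n : nat) : cnt P n.+1 = (cnt P n + P n.+1)%N.
Proof. by rewrite /cnt big_nat_recr. Qed.

Lemma cnt_le (P : pred nat) (n : nat) : (cnt P n <= n)%N.
Proof. by elim: n => [|n IH]; rewrite ?cnt0 // cntS; case: (P _); lia. Qed.

Lemma leq_cnt (P Q : pred nat) (n : nat) :
  (forall m, (0 < m <= n)%N -> P m -> Q m) -> (cnt P n <= cnt Q n)%N.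
Proof.
move=> PQ; rewrite /cnt !big_nat; apply: leq_sum => m mn.
by have := PQ m mn; case: (P m) => // ->.
Qed.

Lemma eq_cnt (P Q : pred nat) (n : nat) :
  (forall m, (0 < m <= n)%N -> P m = Q m) -> cnt P n = cnt Q n.
Proof. by move=> PQ; apply: eq_big_nat => m /PQ ->. Qed.

Lemma leq_cnt_n (P : pred nat) (m n : nat) : (m <= n)%N -> (cnt P m <= cnt P n)%N.
Proof.
move=> mn; elim: n mn => [|n IH]; first by rewrite leqn0 => /eqP ->.
by rewrite leq_eqVlt => /predU1P[-> //|/IH]; rewrite cntS; lia.
Qed.

Lemma cnt_add (P : pred nat) (m n : nat) :
  cnt P (m + n) = (cnt P m + cnt (fun k => P (m + k)) n)%N.
Proof.
elim: n => [|n IH]; first by rewrite addn0 cnt0 addn0.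
by rewrite addnS !cntS IH addnS addnA.
Qed.

Lemma cnt_periodic (P : pred nat) (q k : nat) :
  (forall m, P (m + q)%N = P m) -> cnt P (k * q) = (k * cnt P q)%N.
Proof.
move=> Pq; elim: k => [|k IH]; first by rewrite !mul0n cnt0.
rewrite mulSn addnC cnt_add IH mulSn addnC; congr addn.
apply: eq_cnt => m _; elim: k {IH} => [//|k IH].
by rewrite mulSn addnC addnA addnAC Pq addnC IH.
Qed.

Lemma cnt_scale (G : pred nat) (a n : nat) : (0 < a)%N ->
  cnt (fun m => (a %| m)%N && G (m %/ a)%N) n = cnt G (n %/ a)%N.
Proof.
move=> a0; elim: n => [|n IH]; first by rewrite div0n !cnt0.
by rewrite cntS IH divnS //; case: (boolP (a %| _)%N) => _; rewrite ?addn0 // add1n cntS.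
Qed.

(** The count is exact at multiples of [q], and [n] is trapped between two consecutive ones. *)
Lemma cnt_linear_error (R : realType) (P : pred nat) (q n : nat) : (0 < q)%N ->
  (forall m, P (m + q)%N = P m) ->
  `|(cnt P n)%:R - n%:R * ((cnt P q)%:R / q%:R)| <= q%:R :> R.
Proof.
move=> q0 Pq; have q0' : 0 < q%:R :> R by rewrite ltr0n.
have e1 : n%:R = (n %/ q)%:R * q%:R + (n %% q)%:R :> R.
  by rewrite -natrM -natrD -divn_eq.
have lo : ((n %/ q)%:R * (cnt P q)%:R <= (cnt P n)%:R :> R).
  by rewrite -natrM -cnt_periodic // ler_nat leq_cnt_n // leq_trunc_div.
have hi : ((cnt P n)%:R <= ((n %/ q)%:R + 1) * (cnt P q)%:R :> R).
  rewrite natr1 -natrM -cnt_periodic // ler_nat leq_cnt_n // ltnW //.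
  by rewrite ltn_ceil.
have dq : (cnt P q)%:R / q%:R * q%:R = (cnt P q)%:R :> R by rewrite divfK ?gt_eqF.
have d0 : 0 <= (cnt P q)%:R / q%:R :> R by rewrite divr_ge0.
have cq : (cnt P q)%:R <= q%:R :> R by rewrite ler_nat cnt_le.
have r0 : 0 <= (n %% q)%:R :> R by [].
have rq : (n %% q)%:R <= q%:R :> R by rewrite ler_nat ltnW // ltn_pmod.
set d := (cnt P q)%:R / q%:R in dq d0 *.
have rd0 : 0 <= (n %% q)%:R * d by rewrite mulr_ge0.
have rdq : (n %% q)%:R * d <= (cnt P q)%:R.
  by rewrite -dq [leRHS]mulrC ler_wpM2r.
have -> : n%:R * d = (n %/ q)%:R * (cnt P q)%:R + (n %% q)%:R * d.
  by rewrite [X in X * _]e1 -dq; ring.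
rewrite ler_norml; apply/andP; split; lra.
Qed.

(** For double counting after an exchange of sums: an integer lying in at most one of the classes is
    counted at most once. *)
Lemma leq_sum_exclusive (b : pred nat) (G : bool) (m n : nat) :
  (forall i, (m <= i < n)%N -> b i -> G) ->
  (forall i j, (m <= i < n)%N -> (m <= j < n)%N -> b i -> b j -> i = j) ->
  (\sum_(m <= i < n) b i <= G)%N.
Proof.
move=> bG binj; case: (boolP (has b (index_iota m n))) => [/hasP[i]|/hasPn nb].
  rewrite mem_index_iota => imn bi; rewrite (bG i imn bi).
  rewrite (big_rem i) ?mem_index_iota //= bi big1_seq // => j /andP[_].
  rewrite mem_rem_uniq ?iota_uniq // inE mem_index_iota => /andP[ji jmn].
  by case bj: (b j) => //; move/eqP: ji; case; exact: binj.
by rewrite big1_seq // => i /andP[_ /nb /negbTE ->].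
Qed.

Lemma cnt_coprime (q : nat) : (0 < q)%N -> cnt (coprime q) q = totient q.
Proof.
(* [totient_count_coprime] runs over [[0, q)] and [cnt] over [[1, q]]; the endpoints 0 and [q] have
   the same gcd with [q]. *)
case: q => // q _; rewrite totient_count_coprime big_ltn //.
by rewrite /cnt big_nat_recr //= addnC /coprime gcdn0 gcdnn.
Qed.

(* The sum over [k] counts, over one long period, the integers [k * r] with [r]
   free of prime factors up to [n]: these are distinct and lie in [F]. *)
Lemma density_ge_totient (R : realType) (F : pred nat) (q n : nat) :
  (0 < q)%N -> (forall m, F (m + q)%N = F m) ->
  (forall k r, (0 < k <= n)%N -> F k -> coprime (primorial n) r -> F (k * r)%N) ->
  (totient (primorial n))%:R / (primorial n)%:R * (\sum_(1 <= k < n.+1 | F k) k%:R^-1)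
    <= (cnt F q)%:R / q%:R :> R.
Proof.
move=> q0 Fq Fr; set Q := primorial n; have Q0 : (0 < Q)%N := primorial_gt0 n.
have f0 := fact_gt0 n.
have Qper m : coprime Q (m + Q) = coprime Q m by rewrite /coprime gcdnDr.
(* A multiple of the period [q] that is also divisible by [k * Q] for every positive [k <= n], so
   that all counts below are exact. *)
pose N := (n`! * Q * q)%N.
have cN : cnt F N = (n`! * Q * cnt F q)%N by rewrite cnt_periodic.
have cop k : (0 < k <= n)%N -> 
    (cnt (fun m => (k %| m)%N && coprime Q (m %/ k)%N) N)%:R = 
     (n`! * q * totient Q)%:R / k%:R :> R.
  move=> /andP[k0 kn]; have kf : (k %| n`!)%N by rewrite dvdn_fact ?k0.
  rewrite cnt_scale //; have -> : (N %/ k = (n`! %/ k * q) * Q)%N.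
    rewrite /N -{1}(divnK kf) -[RHS](mulnK _ k0); congr (_ %/ _)%N.
    by move: (n`! %/ k)%N => j; ring.
  rewrite cnt_periodic // cnt_coprime // -[LHS](mulfK (x := k%:R)) ?pnatr_eq0 -?lt0n //.
  by rewrite -natrM; congr (_%:R / _); rewrite -{2}(divnK kf); ring.
suff : \sum_(1 <= k < n.+1 | F k) (n`! * q * totient Q)%:R / k%:R <= (cnt F N)%:R :> R.
  rewrite -mulr_sumr cN !natrM => H.
  rewrite mulrAC ler_pdivrMr ?ltr0n // mulrAC ler_pdivlMr ?ltr0n //.
  rewrite -(ler_pM2l (_ : 0 < n`!%:R :> R)) ?ltr0n //; lra.
rewrite big_mkcond (eq_big_nat _ _ (F2 := fun k => 
  (cnt (fun m => [&& F k, (k %| m)%N & coprime Q (m %/ k)%N]) N)%:R)); last first.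
  move=> k kn; case: ifP => Fk; first by rewrite cop.
  by rewrite /cnt big1.
rewrite -natr_sum ler_nat /cnt exchange_big_nat /=.
rewrite [leqLHS]big_nat [leqRHS]big_nat; apply: leq_sum => m /andP[m0 _].
apply: leq_sum_exclusive => [k kn /and3P[Fk km cm]|k k' kn kn'].
  by rewrite -(divnK km) mulnC Fr.
move=> /and3P[_ km cm] /and3P[_ km' cm'].
(* As [x <= n], all its primes divide [Q], so [x] is coprime to [m %/ y]; since it divides
   [m = y * (m %/ y)], it divides [y]. By symmetry [k = k']. *)
have half x y : (0 < x <= n)%N -> (x %| m)%N -> (y %| m)%N ->
    coprime Q (m %/ y)%N -> (x %| y)%N.
  move=> /andP[x0 xn] xm ym cy; have := coprime_primorial x0 xn cy => cxy.
  by rewrite -(Gauss_dvdl _ cxy) mulnC divnK.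
by apply/eqP; rewrite eqn_dvd (half k k') ?(half k' k).
Qed.

(** * An upper bound sieve for divisor-closed sets *)

Lemma natr_cnt (R : realType) (P : pred nat) (n : nat) (c : R) :
  \sum_(1 <= k < n.+1 | P k) c = (cnt P n)%:R * c.
Proof.
rewrite /cnt natr_sum mulr_suml big_mkcond /=; apply: eq_bigr => k _.
by case: (P k); rewrite ?mul1r ?mul0r.
Qed.

(* Write [ln k] as the sum of [mangoldt d] over the divisors [d] of [k], and
   group the pairs by the cofactor [k / d], which is again in [F]. *)
Lemma sum_ln_divisor_closed (R : realType) (F : pred nat) (x : nat) :
  (forall k d, F k -> (d %| k)%N -> F (k %/ d)%N) ->
  \sum_(1 <= k < x.+1 | F k) ln k%:R <= \sum_(1 <= k < x.+1 | F k) psi R (x %/ k).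
Proof.
move=> Fd.
rewrite big_nat_cond (eq_bigr (fun k => \sum_(1 <= d < x.+1 | (d %| k)%N) mangoldt R d));
  last by move=> k /andP[/andP[k0 kx] _]; rewrite sum_mangoldt_dvd.
rewrite -big_nat_cond (exchange_big_dep_nat predT) //=.
rewrite [leRHS]big_nat_cond.
rewrite [leRHS](eq_bigr (fun k => \sum_(1 <= d < x.+1 | (d * k <= x)%N) mangoldt R d));
  last first.
  move=> k /andP[/andP[k0 kx] _].
  rewrite /psi (big_nat_widen 1 _ x.+1) ?ltnS ?leq_div //.
  by apply: eq_bigl => d; rewrite ltnS leq_divRL.
rewrite -big_nat_cond [leRHS](exchange_big_dep_nat predT) //=.
apply: ler_sum_nat => d /andP[d0 _]; rewrite !natr_cnt ler_wpM2r ?mangoldt_ge0 //.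
rewrite ler_nat (@leq_trans (cnt F (x %/ d))) //.
  rewrite -cnt_scale //; apply: leq_cnt => k _ /andP[Fk dk].
  by rewrite dk Fd.
apply: (@leq_trans (cnt (fun k => F k && (d * k <= x)%N) (x %/ d))).
  by apply: leq_cnt => k /andP[_]; rewrite leq_divRL // mulnC => -> ->.
by rewrite leq_cnt_n // leq_div.
Qed.

(** Split [ln x] as [ln k + ln (x / k)] for each counted [k]. The first parts add up to at most the
    sum of [psi (x %/ k) <= 6 x / k], and [ln (x / k) <= x / k]; hence the 7. *)
Lemma cnt_divisor_closed (R : realType) (F : pred nat) (x : nat) :
  (forall k d, F k -> (d %| k)%N -> F (k %/ d)%N) ->
  (cnt F x)%:R * ln x%:R <= 7 * x%:R * (\sum_(1 <= k < x.+1 | F k) k%:R^-1) :> R.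
Proof.
move=> Fd; rewrite -natr_cnt.
apply: (@le_trans _ _ (\sum_(1 <= k < x.+1 | F k) (ln k%:R + x%:R * k%:R^-1))).
  rewrite big_nat_cond [leRHS]big_nat_cond; apply: ler_sum => k /andP[/andP[k0 kx] _].
  have x0 : (0 < x)%N by lia.
  rewrite -lerBlDl -ln_div ?posrE ?ltr0n //.
  by rewrite ltW // ln_sublinear // divr_gt0 ?ltr0n.
rewrite big_split /= (_ : 7 * x%:R = 6 * x%:R + x%:R :> R); last by ring.
rewrite mulrDl lerD ?mulr_sumr // (le_trans (sum_ln_divisor_closed R x Fd)) //.
rewrite big_nat_cond [leRHS]big_nat_cond; apply: ler_sum => k /andP[/andP[k0 _] _].
rewrite (le_trans (psi_linear R _)) // -mulrA ler_wpM2l //.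
by have [] := divn_floor_bounds R x k0.
Qed.

(** * Integers sorted by their least divisor in [B] *)

Definition sieved (B : pred nat) (a k : nat) : bool :=
  all (fun b => ~~ (B b && (b %| a * k)%N)) (iota 0 a).

Lemma sievedP (B : pred nat) (a k : nat) :
  reflect (forall b, (b < a)%N -> B b -> ~~ (b %| a * k)%N) (sieved B a k).
Proof.
apply: (iffP allP) => [H b ba Bb|H b].
  by have := H b; rewrite mem_iota Bb; exact.
by rewrite mem_iota negb_and => /andP[_ ba]; case: (boolP (B b)) => // /H ->.
Qed.

Lemma sieved_div (B : pred nat) (a k d : nat) :
  sieved B a k -> (d %| k)%N -> sieved B a (k %/ d)%N.
Proof.
move=> /sievedP S dk; apply/sievedP => b ba Bb; apply: contra (S b ba Bb) => H.
by rewrite -(divnK dk) mulnA dvdn_mulr.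
Qed.

Lemma sieved_periodic (B : pred nat) (a k : nat) : ~~ B 0%N ->
  sieved B a (k + a`!) = sieved B a k.
Proof.
move=> B0; rewrite /sieved; apply: eq_in_all => b; rewrite mem_iota add0n /= => ba.
case: b ba => [|b] ba; first by rewrite (negbTE B0).
have bf : (b.+1 %| a`!)%N by rewrite dvdn_fact //= ltnW.
by rewrite mulnDr dvdn_addl // dvdn_mull.
Qed.

Lemma sieved_mul_coprime (B : pred nat) (a k r n : nat) : ~~ B 0%N -> (a <= n)%N ->
  coprime (primorial n) r -> sieved B a k -> sieved B a (k * r)%N.
Proof.
move=> B0 an cop /sievedP S; apply/sievedP => b ba Bb; apply: contra (S b ba Bb).
have b0 : (0 < b)%N by case: b Bb {ba} => //; rewrite (negbTE B0).
by rewrite mulnA Gauss_dvdl // (coprime_primorial b0 _ cop) // (leq_trans (ltnW ba)).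
Qed.

Definition least_divisor (B : pred nat) (a m : nat) : bool :=
  (a %| m)%N && sieved B a (m %/ a)%N.

(** For positive [a] and [B] without 0, this is the natural density of [least_divisor B a]: the
    factorial of [a] is a period of the sieved cofactors, and the last division rescales from
    cofactors to multiples of [a]. *)
Definition least_density (R : realType) (B : pred nat) (a : nat) : R :=
  (cnt (sieved B a) a`!)%:R / a`!%:R / a%:R.

Lemma least_density_ge0 (R : realType) (B : pred nat) (a : nat) :
  0 <= least_density R B a.
Proof. by rewrite /least_density !divr_ge0. Qed.

(** Let [x = n %/ a] and let [S] sum [1 / k] over the sieved [k <= n]. The count times [ln x] is at
    most [7 x S], while the cofactors have density at least [c S / ln n]. Since [ln n <= s ln x],
    the logarithms cancel up to a factor [s], uniformly in [B] and [a]. *)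
Lemma cnt_least_divisor_le (R : realType) : exists2 C : R, 0 < C &
  forall (B : pred nat) (a s n : nat), ~~ B 0%N -> (0 < a)%N -> (a <= n)%N -> (2 <= n)%N ->
    (n <= (n %/ a) ^ s)%N ->
    (cnt (least_divisor B a) n)%:R <= C * s%:R * least_density R B a * n%:R.
Proof.
have [c c0 Hc] := totient_primorial_ln R; exists (7 / c) => [|B a s n B0 a0 an n2 ns].
  by rewrite divr_gt0.
rewrite cnt_scale //; set x := (n %/ a)%N in ns *.
have x0 : (0 < x)%N by rewrite divn_gt0.
have xn : (x <= n)%N by rewrite leq_div.
have L0 : 0 < ln (n%:R : R) by rewrite ln_gt0 // ltr1n.
have Lx : ln (n%:R : R) <= s%:R * ln x%:R.
  rewrite -[leRHS]mulrC mulr_natr -lnXn ?ltr0n // -natrX.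
  by rewrite ler_ln_nat // ltnW.
have H1 := cnt_divisor_closed R x (@sieved_div B a).
have := @density_ge_totient R (sieved B a) a`! n (fact_gt0 a)
  (fun k => sieved_periodic a k B0)
  (fun k r _ Sk cr => sieved_mul_coprime B0 an cr Sk).
set S := (\sum_(1 <= k < n.+1 | sieved B a k) k%:R^-1) => H2.
have S0 : 0 <= S by apply: sumr_ge0 => k _; rewrite invr_ge0.
have {}H1 : (cnt (sieved B a) x)%:R * ln x%:R <= 7 * x%:R * S.
  rewrite (le_trans H1) // ler_wpM2l ?mulr_ge0 //.
  rewrite /S (big_cat_nat (n := x.+1) (p := n.+1)) //= lerDl.
  by apply: sumr_ge0 => k _; rewrite invr_ge0.
have {}H2 : c / ln n%:R * S <= (cnt (sieved B a) a`!)%:R / a`!%:R.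
  by rewrite (le_trans _ H2) // ler_wpM2r // Hc.
rewrite /least_density; move: H2 => {Hc}.
set D := (X in _ <= X -> _); set N := (cnt _ x)%:R in H1 *; set L := ln _ in L0 Lx *.
rewrite mulrAC ler_pdivrMr // => H2.
have D0 : 0 <= D by rewrite divr_ge0.
have xna : x%:R <= n%:R / a%:R :> R by have [] := divn_floor_bounds R n a0.
have N0 : 0 <= N by [].
rewrite -(ler_pM2r (mulr_gt0 L0 c0)).
apply: (@le_trans _ _ (7 * s%:R * (n%:R / a%:R) * (D * L))); last first.
  have cc : c^-1 * c = 1 by rewrite mulVf // gt_eqF.
  by rewrite -/D -[leLHS]mulr1 -[X in _ * X <= _]cc le_eqVlt; apply/orP; left; apply/eqP; ring.
apply: (@le_trans _ _ (7 * s%:R * x%:R * (c * S))); last first.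
  by rewrite ler_pM ?mulr_ge0 // ?ler_wpM2l ?mulr_ge0 // ltW.
rewrite mulrA.
apply: (@le_trans _ _ (N * (s%:R * ln x%:R) * c)).
  by rewrite ler_wpM2r ?ler_wpM2l // ltW.
have -> : 7 * s%:R * x%:R * (c * S) = s%:R * (7 * x%:R * S) * c by ring.
by rewrite mulrCA ler_wpM2r ?ler_wpM2l // ltW.
Qed.

Lemma cnt_least_divisor_linear (R : realType) (B : pred nat) (a : nat) :
  ~~ B 0%N -> (0 < a)%N -> exists K : R, forall n : nat,
  `|(cnt (least_divisor B a) n)%:R - n%:R * least_density R B a| <= K.
Proof.
(* The factorial bounds the error of periodic counting; rounding [n / a] down costs at most 1
   more. *)
move=> B0 a0; exists (a`!%:R + 1) => n; rewrite cnt_scale // /least_density.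
have := cnt_linear_error R (n %/ a) (fact_gt0 a) (fun k => sieved_periodic a k B0).
have [lo hi] := divn_floor_bounds R n a0.
set N := (cnt _ (n %/ a))%:R; set x := (n %/ a)%N in lo hi *.
have d1 : (cnt (sieved B a) a`!)%:R / a`!%:R <= 1 :> R.
  by rewrite ler_pdivrMr ?ltr0n ?fact_gt0 // mul1r ler_nat cnt_le.
have d0 : 0 <= (cnt (sieved B a) a`!)%:R / a`!%:R :> R by rewrite divr_ge0.
set D := (X in X <= 1) in d1; rewrite -/D in d0 *; clearbody D N.
have -> : n%:R * (D / a%:R) = n%:R / a%:R * D by rewrite mulrCA mulrC.
set y := n%:R / a%:R in lo hi *; clearbody y.
have h0 : 0 <= (y - x%:R) * D by rewrite mulr_ge0 // subr_ge0.
have h1 : (y - x%:R) * D <= 1 by rewrite -[leRHS]mulr1 ler_pM ?subr_ge0 //; lra.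
rewrite !ler_norml => /andP[e1 e2]; apply/andP; split; lra.
Qed.

Lemma sum_least_divisor_linear (R : realType) (B : pred nat) (T : nat) :
  ~~ B 0%N -> exists K : R, forall n : nat,
  `|(\sum_(1 <= a < T.+1 | B a) cnt (least_divisor B a) n)%N%:R -
    n%:R * (\sum_(1 <= a < T.+1 | B a) least_density R B a)| <= K.
Proof.
move=> B0; elim: T => [|T [K IH]].
  by exists 0 => n; rewrite !big_geq // mulr0 subrr normr0.
have [K' HK'] := cnt_least_divisor_linear R B0 (ltn0Sn T).
exists (K + K') => n; rewrite big_mkcond [X in _ * X]big_mkcond.
rewrite (big_nat_recr T.+1) //= (big_nat_recr T.+1) //=.
rewrite -!big_mkcond /= natrD mulrDr opprD addrACA (le_trans (ler_normD _ _)) //.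
rewrite lerD ?IH //; case: ifP => _; first exact: HK'.
by rewrite mulr0 subrr normr0 (le_trans _ (HK' 0%N)).
Qed.

(** * The density criterion *)

Definition has_divisor (B : pred nat) (m : nat) : bool :=
  has (fun b => B b && (b %| m)%N) (iota 1 m).

Lemma has_divisorP (B : pred nat) (m : nat) : (0 < m)%N -> ~~ B 0%N ->
  reflect (exists2 b, B b & (b %| m)%N) (has_divisor B m).
Proof.
move=> m0 B0; apply: (iffP hasP) => [[b _ /andP[]]|[b Bb bm]]; first by exists b.
exists b; last by rewrite Bb.
rewrite mem_iota add1n ltnS (dvdn_leq m0 bm) andbT.
by case: b Bb {bm} => //; rewrite (negbTE B0).
Qed.

Lemma sum_least_divisor_le (B : pred nat) (T n : nat) : ~~ B 0%N ->
  (\sum_(1 <= a < T.+1 | B a) cnt (least_divisor B a) n <= cnt (has_divisor B) n)%N.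
Proof.
move=> B0; rewrite /cnt exchange_big_nat /= [leqLHS]big_nat [leqRHS]big_nat.
apply: leq_sum => m /andP[m0 _]; rewrite big_mkcond /=.
rewrite (eq_bigr (fun a => nat_of_bool (B a && least_divisor B a m))); last first.
  by move=> a _; case: (B a).
apply: leq_sum_exclusive => [a _ /and3P[Ba am _]|a a' _ _].
  by apply/has_divisorP => //; exists a.
wlog aa' : a a' / (a < a')%N => [H|].
  have [aa'|aa'|//] := ltngtP a a'; first exact: H.
  by move=> ? ?; apply/esym/H.
move=> /and3P[Ba am _] /and3P[_ a'm /sievedP/(_ a aa' Ba)].
by rewrite mulnC divnK // am.
Qed.

(* Up to rounding, [(n %/ a) ^ s < n] says that [a > n ^ (1 - 1 / s)]. *)
Definition has_large_divisor (B : pred nat) (s n m : nat) : bool :=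
  has_divisor (fun a => B a && ((n %/ a) ^ s < n)%N) m.

(** Take the least divisor [a] of [m] in [B]. If [n <= (n %/ a) ^ s], then [m] is counted in the sum
    at [a]; otherwise [a] itself is a large divisor. *)
Lemma cnt_has_divisor_le (B : pred nat) (s n : nat) : ~~ B 0%N ->
  (cnt (has_divisor B) n <=
   \sum_(1 <= a < n.+1 | B a && (n <= (n %/ a) ^ s)%N) cnt (least_divisor B a) n +
   cnt (has_large_divisor B s n) n)%N.
Proof.
move=> B0; rewrite /cnt exchange_big_nat /= -big_split /= [leqLHS]big_nat [leqRHS]big_nat.
apply: leq_sum => m /andP[m0 mn].
case: has_divisorP => // -[b0 Bb0 b0m].
have ex : exists b, B b && (b %| m)%N by exists b0; rewrite Bb0.
case: (ex_minnP ex) => a /andP[Ba am] amin.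
have a0 : (0 < a)%N by case: a Ba {am amin} => //; rewrite (negbTE B0).
have am' := dvdn_leq m0 am.
have an : (a < n.+1)%N := leq_ltn_trans am' mn.
have [small|large] := leqP n ((n %/ a) ^ s).
  rewrite (big_rem a) ?mem_index_iota ?a0 //= Ba small /=.
  suff -> : least_divisor B a m by [].
  rewrite /least_divisor am; apply/sievedP => b ba Bb.
  by rewrite mulnC divnK //; apply: contraL ba => bm; rewrite -leqNgt amin ?Bb.
suff -> : has_large_divisor B s n m by rewrite addn1.
by apply/has_divisorP; rewrite ?(negbTE B0) //; exists a => //; rewrite Ba.
Qed.

(* A form of the Davenport-Erdos criterion. Sort the multiples by their least
   divisor [a] in [B]: those with [a] not close to [n] have counting functions
   dominated by the summable densities [least_density B a]. *)
Lemma density_criterion (R : realType) (B : pred nat) : ~~ B 0%N ->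
  (forall eps : R, 0 < eps -> exists s n0 : nat, forall n : nat, (n0 <= n)%N ->
     (cnt (has_large_divisor B s n) n)%:R <= eps * n%:R) ->
  cvgn (fun n => (cnt (has_divisor B) n)%:R / n%:R : R).
Proof.
move=> B0 large.
(* The limit of these partial sums will be the density. *)
pose p (T : nat) : R := \sum_(1 <= a < T.+1 | B a) least_density R B a.
have p_ge0 m n : 0 <= \sum_(m <= a < n | B a) least_density R B a.
  by apply: sumr_ge0 => a _; exact: least_density_ge0.
have p_nd : nondecreasing_seq p.
  move=> m n mn; rewrite /p [leRHS](big_cat_nat (n := m.+1)) //= lerDl.
  exact: p_ge0.
(* The disjoint classes up to [T] hold at most [n] integers up to [n], yet their count is [n * p T]
   up to a bounded error. *)
have p_le1 T : p T <= 1.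
  have [K HK] := sum_least_divisor_linear R T B0.
  rewrite leNgt; apply/negP => p1.
  have d0 : 0 < p T - 1 by rewrite subr_gt0.
  pose n := (Num.truncn (K / (p T - 1))).+1.
  have Kn : K < n%:R * (p T - 1) by rewrite -ltr_pdivrMr // truncnS_gt.
  have := HK n; rewrite -/(p T) ler_norml => /andP[+ _].
  have : (\sum_(1 <= a < T.+1 | B a) cnt (least_divisor B a) n)%N%:R <= n%:R :> R.
    by rewrite ler_nat (leq_trans (sum_least_divisor_le T n B0)) // cnt_le.
  lra.
have [l p_cvg p_lim] : exists2 l : R, p n @[n --> \oo]%classic --> l & forall T, p T <= l.
  have p_cvg : cvgn p.
    by apply: nondecreasing_is_cvgn => //; exists 1 => _ [T _ <-]; exact: p_le1.
  by exists (limn p) => // T; exact: nondecreasing_cvgn_le.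
have [C C0 HC] := cnt_least_divisor_le R.
apply/cvg_ex; exists l; apply/cvgrPdist_le => eps eps0.
have e4 : 0 < eps / 4 by rewrite divr_gt0.
have [s [n0 Hn0]] := large _ e4.
have Cs : 0 < C * s%:R + 1 by rewrite ltr_wpDl // mulr_ge0 // ltW.
(* [s] is fixed before [T]: the dominated tail carries a factor [C * s], and [l - p T] has to be
   small against it. *)
have e5 : 0 < eps / 4 / (C * s%:R + 1) by rewrite divr_gt0.
have /cvgrPdist_le/(_ _ e5)[T _ /(_ T (leqnn T))/=] := p_cvg.
rewrite ger0_norm ?subr_ge0 // ler_pdivlMr // => HT.
have [K HK] := sum_least_divisor_linear R T B0.
have K0 : 0 <= K by rewrite (le_trans _ (HK 0%N)).
exists (n0 + T + 2 + (Num.truncn (K / (eps / 4))).+1)%N => // n /= nbig.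
have [n2 n0n Tn] : [/\ 2 <= n, n0 <= n & T < n]%N by split; lia.
have Kn : K <= n%:R * (eps / 4).
  rewrite -ler_pdivrMr // (le_trans (ltW (truncnS_gt _))) // ler_nat.
  exact: leq_trans (leq_addl _ _) nbig.
have n_gt0 : 0 < n%:R :> R by rewrite ltr0n (ltnW n2).
clear nbig.
have := HK n; rewrite -/(p T) ler_norml => /andP[lo hi].
have HT0 : l - p T <= eps / 4.
  by rewrite (le_trans _ HT) // ler_peMr ?subr_ge0 // lerDr mulr_ge0 // ltW.
have low : n%:R * (l - eps / 4) - K <= (cnt (has_divisor B) n)%:R.
  apply: (@le_trans _ _ (\sum_(1 <= a < T.+1 | B a) cnt (least_divisor B a) n)%N%:R).
    have : n%:R * (l - eps / 4) <= n%:R * p T by rewrite ler_wpM2l //; lra.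
    lra.
  by rewrite ler_nat sum_least_divisor_le.
have upp : (cnt (has_divisor B) n)%:R <= n%:R * p T + K + n%:R * (eps / 4) + n%:R * (eps / 4).
  apply: (@le_trans _ _ ((\sum_(1 <= a < n.+1 | B a && (n <= (n %/ a) ^ s)%N)
      cnt (least_divisor B a) n)%N%:R + (cnt (has_large_divisor B s n) n)%:R)).
    by rewrite -natrD ler_nat cnt_has_divisor_le.
  apply: lerD; last by rewrite mulrC Hn0.
  (* Least divisors up to [T] are counted with bounded error; those beyond [T] contribute at most
     [C * s * (l - p T) * n]. *)
  rewrite (big_cat_nat (n := T.+1)) //=; last exact: leqW.
  rewrite natrD; apply: lerD.
    rewrite (le_trans _ (_ :
      (\sum_(1 <= a < T.+1 | B a) cnt (least_divisor B a) n)%N%:R <= _)) //;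
      last by lra.
    rewrite ler_nat big_mkcondr /=; apply: leq_sum => a _; by case: ifP.
  rewrite natr_sum.
  apply: (@le_trans _ _ (\sum_(T.+1 <= a < n.+1 | B a) C * s%:R * least_density R B a * n%:R)).
    rewrite big_mkcondr big_nat_cond [leRHS]big_nat_cond.
    apply: ler_sum => a /andP[/andP[Ta an] Ba]; case: ifP => [small|_].
      rewrite HC //; exact: leq_trans Ta.
    by rewrite !mulr_ge0 ?least_density_ge0 // ltW.
  rewrite -mulr_suml -mulr_sumr mulrC ler_wpM2l //.
  have -> : \sum_(T.+1 <= a < n.+1 | B a) least_density R B a = p n - p T.
    by rewrite /p (big_cat_nat (m := 1) (n := T.+1) (p := n.+1)) //=
      ?[_ + \sum_(T.+1 <= _ < _ | _) _]addrC ?addrK // leqW.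
  have : p n - p T <= l - p T by rewrite lerD2r.
  have pn : 0 <= p n - p T by rewrite subr_ge0 p_nd // ltnW.
  have : C * s%:R * (p n - p T) <= C * s%:R * (l - p T).
    by rewrite ler_wpM2l ?lerD2r // mulr_ge0 // ltW.
  have : 0 <= l - p T by rewrite subr_ge0.
  lra.
have ppT : n%:R * p T <= n%:R * l by rewrite ler_wpM2l.
rewrite distrC ler_norml; apply/andP; split.
  rewrite lerBrDr ler_pdivlMr //.
  have : 0 <= n%:R * eps by rewrite mulr_ge0 // ltW.
  lra.
rewrite lerBlDr ler_pdivrMr //.
have : 0 <= n%:R * eps by rewrite mulr_ge0 // ltW.
lra.
Qed.

(** * Integers with a large prime divisor *)

Lemma cnt_prime_divisor_le (R : realType) (y n : nat) :
  (cnt (has_divisor (fun p => prime p && (y < p)%N)) n)%:R <=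
  n%:R * (\sum_(y.+1 <= p < n.+1 | prime p) p%:R^-1) :> R.
Proof.
apply: (@le_trans _ _ (\sum_(y.+1 <= p < n.+1 | prime p) cnt (dvdn p) n)%N%:R).
  rewrite ler_nat /cnt exchange_big_nat /= [leqLHS]big_nat [leqRHS]big_nat.
  apply: leq_sum => m /andP[m0 mn]; case: has_divisorP => // -[p /andP[pp yp] pm].
  rewrite (big_rem p) ?mem_index_iota ?yp /=; first by rewrite pp pm.
  exact: leq_ltn_trans (dvdn_leq m0 pm) mn.
rewrite natr_sum mulr_sumr; apply: ler_sum => p /prime_gt0 p0.
have -> : cnt (dvdn p) n = (n %/ p)%N.
  have := cnt_scale predT n p0; rewrite (eq_cnt (Q := dvdn p)) => [->|m _].
    by rewrite /cnt sum_nat_const_nat muln1 subSS subn0.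
  by rewrite andbT.
by have [] := divn_floor_bounds R n p0.
Qed.

(** Logarithmic form of [p > n ^ (1 - 3 / s)]; the 3 pays for the three factors lost in
    [near_prime_of_large]. *)
Definition near_prime (R : realType) (s n p : nat) : bool :=
  prime p && ((1 - 3 / s%:R) * ln n%:R < ln p%:R :> R).

Lemma cnt_near_prime_divisor (R : realType) (eps : R) : 0 < eps ->
  exists s n0 : nat, (0 < s)%N /\ forall n : nat, (n0 <= n)%N ->
    (cnt (has_divisor (near_prime R s n)) n)%:R <= eps * n%:R.
Proof.
(* [s] ensures [3 / s <= eps / 8] and [3 / s <= 1 / 2]; [n0] ensures [8 <= eps / 8 * ln n] and
   [ln n >= 4], so that [ln y >= ln n / 4] for the cutoff [y] below. *)
move=> eps0; pose s := (6 + (Num.truncn (24 / eps)).+1)%N.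
pose n0 := (Num.truncn (expR (4 + 64 / eps))).+1.
exists s, n0; split=> // n n0n.
have s6 : 6 <= s%:R :> R by rewrite ler_nat leq_addr.
have s0 : 0 < s%:R :> R by lra.
have s24 : 24 <= eps * s%:R.
  rewrite mulrC -ler_pdivrMr // (le_trans (ltW (truncnS_gt _))) // ler_nat.
  exact: leq_addl.
have n_gt0 : (0 < n)%N by exact: leq_trans n0n.
have n_gt0' : 0 < n%:R :> R by rewrite ltr0n.
have Lbig : 4 + 64 / eps <= ln (n%:R : R).
  rewrite -ler_expR lnK ?posrE // (le_trans (ltW (truncnS_gt _))) // ler_nat //.
set L := ln n%:R in Lbig.
have e64 : 0 < 64 / eps by rewrite divr_gt0.
pose th : R := 1 - 3 / s%:R.
have s3 : 3 / s%:R <= 1 / 2 :> R by rewrite ler_pdivrMr //; lra.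
have s3' : 0 < 3 / s%:R :> R by rewrite divr_gt0.
pose Y := expR (th * L); pose y := Num.truncn Y.
have thL : 0 <= th * L by rewrite mulr_ge0 // /th; lra.
have Y1 : 1 <= Y by rewrite -expR0 ler_expR.
have yY : y%:R <= Y by rewrite truncn_le expR_ge0.
have Yy : Y < y.+1%:R by rewrite truncnS_gt.
have y0 : (0 < y)%N by rewrite truncn_gt0.
have yn : (y <= n)%N.
  rewrite -(ler_nat R) (le_trans yY) // -[leRHS]lnK ?posrE // ler_expR -/L.
  by rewrite ler_piMl ?/th; lra.
(* [Y < y + 1 <= 2 y], so truncation loses at most [ln 2 <= 1]. *)
have lny : th * L - 1 <= ln y%:R.
  have : ln Y <= ln (2 * y%:R).
    rewrite ler_ln ?posrE ?mulr_gt0 ?ltr0n ?expR_gt0 // (le_trans (ltW Yy)) //.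
    by rewrite -natrM ler_nat mul2n -addnn -addn1 leq_add2l.
  rewrite expRK lnM ?posrE ?ltr0n //; have := ln2_le1 R; lra.
have thL2 : L - (3 / s%:R) * L = th * L by rewrite /th mulrBl mul1r.
apply: (@le_trans _ _ (cnt (has_divisor (fun p => prime p && (y < p)%N)) n)%:R).
  rewrite ler_nat; apply: leq_cnt => m /andP[m0 _].
  case: has_divisorP => // -[p /andP[pp np] pm] _; apply/has_divisorP => //.
  exists p => //; rewrite pp /= -(ltr_nat R) (le_lt_trans yY) //.
  by rewrite -[ltRHS]lnK ?posrE ?ltr0n ?prime_gt0 // ltr_expR.
apply: (le_trans (cnt_prime_divisor_le R y n)); rewrite mulrC ler_wpM2r //.
have := sum_inv_prime_range R y0 yn; rewrite -/L.
set S := \sum_(_ <= _ < _ | _) _ => HS.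
have S0 : 0 <= S by apply: sumr_ge0 => p _; rewrite invr_ge0.
have L4 : 0 < L / 4 by lra.
have : L / 4 * S <= ln y%:R * S.
  rewrite ler_wpM2r // (le_trans _ lny) // -thL2.
  have : 3 / s%:R * L <= 1 / 2 * L by rewrite ler_wpM2r //; lra.
  lra.
move=> H; rewrite -(ler_pM2l L4) (le_trans H) // (le_trans HS) //.
have e1 : 3 / s%:R * L <= eps / 8 * L.
  by rewrite ler_wpM2r ?ler_pdivrMr //; lra.
have e2 : 64 <= eps * L.
  have -> : 64 = eps * (64 / eps) by rewrite mulrC divfK // gt_eqF.
  by rewrite ler_wpM2l // ?ltW //; lra.
lra.
Qed.

(** * Thresholds, density and primitivity of scaled unions *)

(** With [x = n %/ (e * p)] one has [n <= 2 * x * e * p], where 2, [x] and [e] are each at most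
    [n ^ (1 / s)], strictly for [x]. *)
Lemma near_prime_of_large (R : realType) (e p s n : nat) :
  (0 < s)%N -> (0 < e)%N -> prime p -> (e * p <= n)%N -> (e ^ s <= n)%N ->
  (2 ^ s <= n)%N -> ((n %/ (e * p)) ^ s < n)%N -> near_prime R s n p.
Proof.
move=> s0 e0 pp epn en tn xn; rewrite /near_prime pp /=.
have p0 := prime_gt0 pp; have ep0 : (0 < e * p)%N by rewrite muln_gt0 e0.
set x := (n %/ (e * p))%N in xn; have x0 : (0 < x)%N by rewrite divn_gt0.
have n0 : (0 < n)%N by apply: leq_trans epn.
have lnpow k : (0 < k)%N -> (k ^ s <= n)%N -> s%:R * ln k%:R <= ln (n%:R : R).
  move=> k0 kn; rewrite mulrC mulr_natr -lnXn ?ltr0n // -natrX.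
  by rewrite ler_ln_nat // expn_gt0 k0.
have nle : (n <= 2 * x * (e * p))%N.
  rewrite ltnW // (leq_trans (ltn_ceil n ep0)) // leq_mul2r -/x; apply/orP; right.
  by rewrite mul2n -addnn -addn1 leq_add2l.
have Ln : ln (n%:R : R) <= ln 2 + ln x%:R + (ln e%:R + ln p%:R).
  rewrite -!lnM ?posrE ?mulr_gt0 ?ltr0n // -!natrM.
  exact: ler_ln_nat.
have s0' : 0 < s%:R :> R by rewrite ltr0n.
have lnx : s%:R * ln x%:R < ln (n%:R : R).
  rewrite mulrC mulr_natr -lnXn ?ltr0n // -natrX.
  by rewrite ltr_ln ?posrE ?ltr0n ?expn_gt0 ?x0 // ltr_nat.
rewrite -(ltr_pM2l s0') mulrA mulrBr mulr1 [s%:R * (_ / _)]mulrC divfK ?gt_eqF //.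
have := lnpow _ e0 en; have := lnpow 2%N isT tn.
have := ler_wpM2l (ltW s0') Ln; lra.
Qed.

(* The power makes [e i] at most [p ^ (1 / i)] for the primes [p] in [A i]; the sum
   keeps these primes from dividing any of [e 1] to [e i]. *)
Definition sieve_threshold (e : nat -> nat) (i : nat) : nat :=
  (e i ^ i + \sum_(1 <= j < i.+1) e j).+1.

Lemma besicovitch_union_scaled (R : realType) (e : nat -> nat) (A : nat -> set nat) :
  (forall i, (1 <= i)%N -> (0 < e i)%N) -> admissible (sieve_threshold e) A ->
  besicovitch R (union_scaled e A).
Proof.
move=> he adm; pose B b := `[< union_scaled e A b >].
have elt b : B b -> exists i p,
    [/\ (1 <= i)%N, prime p, (sieve_threshold e i <= p)%N & b = (e i * p)%N].
  move=> /asboolP[i /= i1 [p Aip <-]]; exists i, p.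
  by have [_ /(_ p Aip)[[pp _] /= Kp]] := adm i i1.
have B0 : ~~ B 0%N.
  apply/negP => /elt[i [p [i1 pp _ ip0]]].
  by have := prime_gt0 pp; have := he i i1; case: (e i) ip0 => // ei; case: p pp.
have counts n : count_upto (multiples (union_scaled e A)) n = cnt (has_divisor B) n.
  rewrite /count_upto big_mkcond; apply: eq_big_nat => m /andP[m0 _].
  have -> : (m%:Z \in multiples (union_scaled e A)) = has_divisor B m.
    apply/idP/has_divisorP => // [/set_mem[b /= Bb bm]|[b /asboolP Bb bm]].
      by exists b => //; apply/asboolP.
    by apply/mem_set; exists b.
  by case: has_divisor.
rewrite /besicovitch /has_density (_ : density_seq R _ =
  fun n => (cnt (has_divisor B) n)%:R / n%:R); last first.
  by apply/funext => n; rewrite /density_seq counts.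
apply: density_criterion => // eps eps0.
have [s [n0 [s0 Hn0]]] := cnt_near_prime_divisor eps0.
exists s, (n0 + 2 ^ s + \sum_(1 <= i < s) e i ^ s)%N => n nbig.
have n0n : (n0 <= n)%N by apply: leq_trans nbig; rewrite -addnA leq_addr.
have sn : (2 ^ s <= n)%N by apply: leq_trans nbig; rewrite addnAC leq_addl.
have en : (\sum_(1 <= i < s) e i ^ s <= n)%N by apply: leq_trans nbig; rewrite leq_addl.
apply: le_trans (Hn0 n n0n); rewrite ler_nat; apply: leq_cnt => m /andP[m0 mn].
move=> /(has_divisorP m0 _)[|b /andP[Bb bn] bm]; first by rewrite (negbTE B0).
have [i [p [i1 pp Kp bip]]] := elt b Bb.
have b_le : (e i * p <= n)%N by rewrite -bip (leq_trans (dvdn_leq m0 bm)).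
apply/has_divisorP => //; exists p; last by rewrite (dvdn_trans _ bm) // bip dvdn_mull.
apply: (@near_prime_of_large R (e i)); rewrite -?bip ?he //; first by rewrite bip.
(* For [i >= s] the threshold gives [e i ^ s <= e i ^ i < p <= n]; the finitely many [i < s] are
   covered by the lower bound on [n]. *)
have [si|i_s] := leqP s i.
  rewrite (leq_trans (leq_pexp2l (he i i1) si)) //.
  rewrite (leq_trans _ b_le) // (leq_trans _ (leq_pmull p (he i i1))) //.
  by rewrite (leq_trans _ Kp) // /sieve_threshold -addSn ltnW // ltnS leq_addr.
apply: leq_trans en; rewrite (big_rem i) ?mem_index_iota ?i1 //=.
exact: leq_addr.
Qed.

(** Let [e i * p] divide [e j * q]. If [p = q], primitivity gives [e i = e j]. Otherwise [p] divides
    [e j], which is impossible for [j <= i] as then [e j < p]. For [i < j], [q] exceeds [e i] and is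
    coprime to [e i * p], so [e i] divides [e j]; then [e i = e j] is divisible by [p > e i], a
    contradiction. *)
Lemma primitive_union_scaled (e : nat -> nat) (A : nat -> set nat) :
  (forall i, (1 <= i)%N -> (0 < e i)%N) -> primitive (range_from1 e) ->
  admissible (sieve_threshold e) A -> primitive (union_scaled e A).
Proof.
move=> he prim adm _ _ [i /= i1 [p Aip <-]] [j /= j1 [q Ajq <-]] dv.
have [_ /(_ p Aip)[[pp _] /= Kp]] := adm i i1.
have [_ /(_ q Ajq)[[qp _] /= Kq]] := adm j j1.
have eK k i' r : (1 <= k <= i')%N -> (sieve_threshold e i' <= r)%N -> (e k < r)%N.
  move=> /andP[k1 ki]; apply: leq_trans; rewrite ltnS.
  by rewrite (big_rem k) ?mem_index_iota ?k1 //= addnCA leq_addr.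
have primE : (e i %| e j)%N -> e i = e j by apply: prim; [exists i|exists j].
have ndvd k r : (1 <= k)%N -> (e k < r)%N -> ~~ (r %| e k)%N.
  by move=> k1 ekr; apply/negP => /(dvdn_leq (he k k1)); rewrite leqNgt ekr.
have [pq|pq] := eqVneq p q.
  by rewrite pq dvdn_pmul2r ?prime_gt0 // in dv *; rewrite primE.
have cpq : coprime p q by rewrite prime_coprime // dvdn_prime2.
have pej : (p %| e j)%N.
  by rewrite -(Gauss_dvdl _ cpq) (dvdn_trans _ dv) // dvdn_mull.
have [ji|ij] := leqP j i.
  by move: pej; rewrite (negbTE (ndvd j p j1 (eK _ _ _ _ Kp))) ?j1.
have cq : coprime (e i * p) q.
  rewrite coprimeMl cpq andbT coprime_sym prime_coprime //.
  by rewrite ndvd // (eK _ j) // i1 ltnW.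
have := dv; rewrite Gauss_dvdl // => eipj.
have eij := primE (dvdn_trans (dvdn_mulr _ (dvdnn _)) eipj).
have epi : (e i < p)%N by rewrite (eK _ _ _ _ Kp) // i1 leqnn.
by move: pej; rewrite -eij (negbTE (ndvd i p i1 epi)).
Qed.

Theorem theorem1p13 (R : realType) (e : nat -> nat)
    (he : forall i : nat, (1 <= i)%N -> (0 < e i)%N) :
  (exists K : nat -> nat,
     (forall i : nat, (1 <= i)%N -> (0 < K i)%N) /\
     forall A : nat -> set nat, admissible K A ->
       besicovitch R (union_scaled e A)) /\
  (primitive (range_from1 e) ->
   exists K : nat -> nat,
     (forall i : nat, (1 <= i)%N -> (0 < K i)%N) /\
     forall A : nat -> set nat, admissible K A ->
       besicovitch R (union_scaled e A) /\ primitive (union_scaled e A)).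
Proof.
split=> [|prim]; exists (sieve_threshold e); split=> // A adm.
  exact: besicovitch_union_scaled.
split; [exact: besicovitch_union_scaled | exact: primitive_union_scaled].
Qed.
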